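(* For every $n\ge1$ there is a bijection between the set of matchings on $[2n]$ that avoid the pattern $12312$ and the set of oscillating tableaux of length $2n$, $\emptyset=\lambda^0,\lambda^1,\dots,\lambda^{2n}=\emptyset$, such that every $\lambda^i$ is a partition of shape $(k)$ (for some $k\ge0$) or $(k,1)$ (for some $k\ge1$), and such that no partition $\lambda^i=(k,1)$ is immediately followed by $\lambda^{i+1}=(k+1,1)$.
   Context: An oscillating tableau of length $\ell$ is a sequence of partitions (Young diagrams) $\emptyset=\lambda^0,\lambda^1,\dots,\lambda^{\ell}=\emptyset$ such that each $\lambda^i$ is obtained from $\lambda^{i-1}$ by adding one square or removing one square. A matching on $[2n]$ is a partition of $[2n]$ into $n$ blocks of size two (edges). The canonical sequential form of a matching with $n$ edges is the word of length $2n$ obtained by labeling edges $1,\dots,n$ in increasing order of their smaller elements and writing at each position the label of the edge containing it. Words $a_1\cdots a_k$, $b_1\cdots b_k$ are order-isomorphic if $a_i<a_j\iff b_i<b_j$ for all $i,j$. A matching contains a pattern $\tau$ if its canonical sequential form has a subsequence order-isomorphic to $\tau$, and avoids $\tau$ otherwise. *)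

(* Defs.v *)
From HB Require Import structures.
From mathcomp Require Import all_boot.
Set Implicit Arguments.
Unset Strict Implicit.
Unset Printing Implicit Defensive.

(* The ground set [2n] is represented by 'I_(2 * n), i.e. 0-based. *)
Definition is_matching (n : nat) (M : {set {set 'I_(2 * n)}}) : bool :=
  [&& partition M [set: 'I_(2 * n)], #|M| == n & [forall B in M, #|B| == 2]].

(* The neutral value m is never reached on a nonempty B. *)
Definition edge_min (m : nat) (B : {set 'I_m}) : nat :=
  \big[minn/m]_(i in B) (i : nat).

(* The rank of the edge B, counted from 1, when the edges are listed by
   increasing smaller element. *)
Definition edge_label (m : nat) (M : {set {set 'I_m}}) (B : {set 'I_m}) : nat :=
  #|[set C in M | edge_min C <= edge_min B]|.

Definition canonical_form (m : nat) (M : {set {set 'I_m}}) : seq nat :=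
  [seq edge_label M (pblock M i) | i <- enum 'I_m].

Definition order_iso (a b : seq nat) : bool :=
  (size a == size b) &&
  [forall i : 'I_(size a), forall j : 'I_(size a),
     (nth 0 a i < nth 0 a j) == (nth 0 b i < nth 0 b j)].

(* The subsequences of w are the words mask c w. *)
Definition word_contains (w tau : seq nat) : bool :=
  [exists c : (size w).-tuple bool, order_iso (mask c w) tau].

Definition avoids (m : nat) (M : {set {set 'I_m}}) (tau : seq nat) : bool :=
  ~~ word_contains (canonical_form M) tau.

(* Partitions are written without zero parts, so the empty one is [::]. *)
Definition is_partn (la : seq nat) : bool := sorted geq la && (0 \notin la).

(* incr_nth la (size la) opens a new row. *)
Definition add_square (la mu : seq nat) : bool :=
  [exists i : 'I_(size la).+1, mu == incr_nth la i].

Definition osc_step (la mu : seq nat) : bool :=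
  add_square la mu || add_square mu la.

Definition is_osc_tableau (l : nat) (t : l.+1.-tuple (seq nat)) : bool :=
  [&& all is_partn t, tnth t ord0 == [::], tnth t ord_max == [::]
    & sorted osc_step t].

(* On partitions: shape (k) with k >= 0, where (0) is [::], or (k, 1) with
   k >= 1; positivity of k comes from is_partn. *)
Definition row_or_near_row (la : seq nat) : bool :=
  match la with
  | [::] | [:: _] | [:: _; 1] => true
  | _ => false
  end.

(* la = (k, 1) and mu = (k + 1, 1) for some k. *)
Definition forbidden_step (la mu : seq nat) : bool :=
  match la, mu with
  | [:: k; 1], [:: k'; 1] => k' == k.+1
  | _, _ => false
  end.

Definition restricted_osc_tableau (l : nat) (t : l.+1.-tuple (seq nat)) : bool :=
  [&& is_osc_tableau t, all row_or_near_row t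
    & sorted [rel la mu | ~~ forbidden_step la mu] t].

(* Main.v *)
Require Import Defs.
From HB Require Import structures.
From mathcomp Require Import all_boot.
From mathcomp Require Import zify.

Set Implicit Arguments.
Unset Strict Implicit.
Unset Printing Implicit Defensive.

(** Read the canonical form of a matching from left to right. It avoids 12312
    iff each closer closes either the largest label seen so far or the largest
    open label below it. Hence the number of ways to complete a prefix by [N]
    letters depends only on the number [k] of open labels below the largest one
    and on whether the largest one is closed ([F N k] ways) or open ([G N k]
    ways), with
      [F N.+1 k = G N k + F N k.-1],
      [G N.+1 k = G N k.+1 + F N k + G N k.-1],
    the terms in [k.-1] being absent for [k = 0]. If [R N k] and [H N k] count
    the ways to complete a tableau by [N] steps from the shapes [(k)] and
    [(k, 1)], then [R N k] and [R N k.+1 + H N k] satisfy the same recursion,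
    since from [(k, 1)] one can only remove a square. So both families have
    equally long duplicate-free enumerations. *)

(** * Equinumerous enumerated types *)

Lemma bijective_enumeration (A : choiceType) (C : eqType) (f : A -> C) (s : seq C) :
  injective f -> uniq s -> (forall c, c \in s <-> exists a, f a = c) ->
  exists g : A -> 'I_(size s), bijective g.
Proof.
move=> f_inj s_uniq fs.
have idx a : index (f a) s < size s by rewrite index_mem; apply/fs; exists a.
have preimage (i : 'I_(size s)) : exists a, f a == tnth (in_tuple s) i.
  by have [a <-] := (fs _).1 (mem_tnth i (in_tuple s)); exists a.
exists (fun a => Ordinal (idx a)).
exists (fun i => xchoose (preimage i)) => [a|i].
  apply: f_inj; rewrite (eqP (xchooseP (preimage _))).
  by rewrite (tnth_nth (f a)) /= nth_index //; apply/fs; exists a.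
apply: val_inj; rewrite /= (eqP (xchooseP (preimage _))).
by rewrite (tnth_nth (tnth (in_tuple s) i)) /= index_uniq.
Qed.

Lemma bijective_of_enumerations (A B : choiceType) (C D : eqType)
    (f : A -> C) (g : B -> D) (s : seq C) (t : seq D) :
  injective f -> uniq s -> (forall c, c \in s <-> exists a, f a = c) ->
  injective g -> uniq t -> (forall d, d \in t <-> exists b, g b = d) ->
  size s = size t -> exists h : A -> B, bijective h.
Proof.
move=> f_inj s_uniq fs g_inj t_uniq gt st.
have [i i_bij] := bijective_enumeration f_inj s_uniq fs.
have [j [j' jK j'K]] := bijective_enumeration g_inj t_uniq gt.
exists (j' \o cast_ord st \o i); apply: bij_comp i_bij; apply: bij_comp.
  by exists j.
by exists (cast_ord (esym st)); [exact: cast_ordK | exact: cast_ordKV].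
Qed.

(** * Words read by an automaton *)

Section Runs.

Variables (S : Type) (L : eqType).
Variables (letters : S -> seq L) (next : S -> L -> S) (final : pred S).

Fixpoint runs (N : nat) (s : S) : seq (seq L) :=
  if N is N'.+1 then [seq x :: w | x <- letters s, w <- runs N' (next s x)]
  else if final s then [:: [::]] else [::].

Fixpoint accepts (s : S) (w : seq L) : bool :=
  if w is x :: w' then (x \in letters s) && accepts (next s x) w' else final s.

Lemma mem_runs N s w : (w \in runs N s) = (size w == N) && accepts s w.
Proof.
elim: N s w => [|N IH] s [|x w] /=; try by case: (final s); rewrite ?inE.
  by apply/negP => /allpairsPdep [y [v []]].
rewrite eqSS andbCA -IH; apply/allpairsPdep/andP.
  by case=> [y [v [sy rv [-> ->]]]].
by case=> sx rw; exists x, w.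
Qed.

Lemma runs_uniq : (forall s, uniq (letters s)) -> forall N s, uniq (runs N s).
Proof.
move=> letters_uniq; elim=> [|N IH] s /=; first by case: (final s).
apply: allpairs_uniq_dep => //.
by move=> _ _ /allpairsPdep [x [w [_ _ ->]]] /allpairsPdep [y [v [_ _ ->]]] [-> ->].
Qed.

Lemma size_runs0 s : size (runs 0 s) = final s.
Proof. by rewrite /=; case: (final s). Qed.

Lemma size_runsS N s :
  size (runs N.+1 s) = \sum_(x <- letters s) size (runs N (next s x)).
Proof. by rewrite /= size_allpairs_dep sumnE big_map. Qed.

Lemma acceptsP s w :
  accepts s w <->
  (forall u x v, w = u ++ x :: v -> x \in letters (foldl next s u)) /\
  final (foldl next s w).
Proof.
elim: w s => [|x w IH] s /=; first by split=> [|[]] //; split=> // [[]].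
split=> [/andP [sx /IH [lw fw]]|[lw fw]].
  by split=> // [[|y u] z v [<- wE]] //; apply: lw wE.
apply/andP; split; first exact: lw [::] x w erefl.
by apply/IH; split=> // u y v wE; apply: (lw (x :: u) y v); rewrite wE.
Qed.

End Runs.

(** * Subsequences and counting *)

Lemma iota_rcons m n : iota m n.+1 = rcons (iota m n) (m + n).
Proof. by rewrite -addn1 iotaD cats1. Qed.

Lemma subseq_cat_cons (T : eqType) (s1 s2 : seq T) (x : T) (w : seq T) :
  subseq (s1 ++ x :: s2) w ->
  exists u v, [/\ w = u ++ x :: v, subseq s1 u & subseq s2 v].
Proof.
elim: w s1 => [|z w IH] s1; first by case: s1.
have skip_head : subseq (s1 ++ x :: s2) w ->
    exists u v, [/\ z :: w = u ++ x :: v, subseq s1 u & subseq s2 v].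
  case/IH=> [u [v [-> s1u s2v]]]; exists (z :: u), v; split=> //.
  exact: subseq_trans s1u (subseq_cons u z).
case: s1 skip_head => [|y s1] skip_head /=; case: eqP => [->|_] // sw.
  by exists [::], w.
have [u [v [-> s1u s2v]]] := IH s1 sw.
by exists (z :: u), v; split=> //=; rewrite eqxx.
Qed.

Lemma count_mem_rcons (T : eqType) (x y : T) (s : seq T) :
  count_mem x (rcons s y) = count_mem x s + (y == x).
Proof. by rewrite -cats1 count_cat /= addn0. Qed.

(** * Open labels of a prefix *)

Definition max_label (p : seq nat) : nat := \max_(y <- p) y.

Definition is_open (p : seq nat) (y : nat) : bool := count_mem y p == 1.

Definition max_open (p : seq nat) : bool := is_open p (max_label p).

Definition open_below_max (p : seq nat) : seq nat :=
  [seq y <- rev (iota 0 (max_label p)) | is_open p y].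

Definition next_labels (p : seq nat) : seq nat :=
  (max_label p).+1 ::
  (if max_open p then [:: max_label p] else [::]) ++ take 1 (open_below_max p).

Definition all_closed (p : seq nat) : bool := ~~ has (is_open p) p.

Lemma leq_max_label p y : y \in p -> y <= max_label p.
Proof. by move=> py; apply: (leq_bigmax_seq (F := id)). Qed.

Lemma max_label_notin p : (max_label p).+1 \notin p.
Proof. by apply/negP => /leq_max_label; rewrite ltnn. Qed.

Lemma max_label_rcons p x : max_label (rcons p x) = maxn (max_label p) x.
Proof. by rewrite /max_label -cats1 big_cat big_seq1. Qed.

Lemma max_label_rcons_mem p x : x \in p -> max_label (rcons p x) = max_label p.
Proof. by move=> px; rewrite max_label_rcons (maxn_idPl (leq_max_label px)). Qed.

Lemma max_label_opener p : max_label (rcons p (max_label p).+1) = (max_label p).+1.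
Proof. by rewrite max_label_rcons (maxn_idPr (leqnSn _)). Qed.

Lemma max_label_initial p x :
  0 < x -> (forall y, (y \in p) = (0 < y < x)) -> x = (max_label p).+1.
Proof.
case: x => // k _ pE; congr S; apply/eqP; rewrite eqn_leq andbC; apply/andP; split.
  by apply/bigmax_leqP_seq => y; rewrite pE ltnS => /andP [].
by case: k pE => // k pE; apply: leq_max_label; rewrite pE leqnn.
Qed.

Lemma is_open_mem p y : is_open p y -> y \in p.
Proof. by move/eqP=> cy; rewrite -has_pred1 has_count cy. Qed.

Lemma is_open_rcons p x y :
  is_open (rcons p x) y = if x == y then y \notin p else is_open p y.
Proof.
rewrite /is_open count_mem_rcons; have [_|_] := eqVneq x y; last by rewrite addn0.
by rewrite addn1 eqSS -has_pred1 has_count -eqn0Ngt.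
Qed.

Lemma mem_open_below_max p y :
  (y \in open_below_max p) = is_open p y && (y < max_label p).
Proof. by rewrite mem_filter mem_rev mem_iota. Qed.

Lemma open_below_max_sorted p : sorted gtn (open_below_max p).
Proof.
apply: sorted_filter; first exact: rev_trans ltn_trans.
by rewrite rev_sorted; apply: iota_ltn_sorted.
Qed.

Lemma open_below_max_cons p a s : open_below_max p = a :: s ->
  [/\ is_open p a, a < max_label p & {in s, forall y, y < a}].
Proof.
move=> pE; have := open_below_max_sorted p; rewrite pE /=.
move/(order_path_min (rev_trans ltn_trans))/allP => s_lt.
by have := mem_open_below_max p a; rewrite pE mem_head => /esym /andP [].
Qed.

Lemma next_labels_uniq p : uniq (next_labels p).
Proof.
rewrite /next_labels; case oE : (open_below_max p) => [|a s] /=.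
  by case: max_open; rewrite //= inE gtn_eqF.
have [_ am _] := open_below_max_cons oE.
by case: max_open; rewrite /= take0 /= !inE; lia.
Qed.

Lemma next_labelsP p x :
  reflect (x = (max_label p).+1 \/
           is_open p x /\ forall y, x < y < max_label p -> ~~ is_open p y)
          (x \in next_labels p).
Proof.
rewrite inE mem_cat; apply: (iffP predU1P) => -[->|]; try by left.
  case/orP=> [x_max|x_below]; right.
    by case: ifP x_max => // om; rewrite inE => /eqP ->; split=> // y; lia.
  case oE : (open_below_max p) x_below => [|a s] //=; rewrite take0 inE => /eqP ->.
  have [oa _ s_lt] := open_below_max_cons oE; split=> // y /andP [ay ym].
  apply/negP => oy; have := mem_open_below_max p y; rewrite oE inE oy ym.
  by case/predU1P => [|/s_lt]; lia.
case=> ox x_top; right; apply/orP.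
have := leq_max_label (is_open_mem ox); rewrite leq_eqVlt => /predU1P [xm|xm].
  by left; rewrite /max_open -xm ox mem_head.
right; have := mem_open_below_max p x; rewrite ox xm.
case oE : (open_below_max p) => [|a s] //=; have [oa am s_lt] := open_below_max_cons oE.
rewrite take0 !inE => /predU1P [->|/s_lt xa]; first exact: eqxx.
by have := x_top a; rewrite xa am oa => /(_ isT).
Qed.

Lemma all_closedE p : all_closed p = ~~ max_open p && nilp (open_below_max p).
Proof.
apply/hasPn/andP => [closed|[closed_max /nilP below] y py].
  have closedE y : is_open p y = false.
    by apply/negP => oy; have := closed y (is_open_mem oy); rewrite oy.
  rewrite /max_open closedE /nilp size_filter eqn0Ngt -has_count.
  by rewrite (eq_has closedE) has_pred0.
have := leq_max_label py; rewrite leq_eqVlt => /predU1P [-> //|ym].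
by have := mem_open_below_max p y; rewrite below ym andbT => <-.
Qed.

Lemma max_open_opener p : max_open (rcons p (max_label p).+1).
Proof. by rewrite /max_open max_label_opener is_open_rcons eqxx max_label_notin. Qed.

Lemma open_below_max_opener p :
  open_below_max (rcons p (max_label p).+1) =
  if max_open p then max_label p :: open_below_max p else open_below_max p.
Proof.
transitivity [seq y <- rev (iota 0 (max_label p).+1) | is_open p y].
  rewrite /open_below_max max_label_opener.
  apply: eq_in_filter => y; rewrite mem_rev mem_iota is_open_rcons /= add0n => ym.
  by rewrite gtn_eqF.
by rewrite iota_rcons rev_rcons.
Qed.

Lemma open_below_max_closer p x : is_open p x ->
  open_below_max (rcons p x) = [seq y <- open_below_max p | y != x].
Proof.
move=> ox; rewrite -filter_predI /open_below_max max_label_rcons_mem ?is_open_mem //.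
apply: eq_filter => y /=; rewrite is_open_rcons [y == x]eq_sym.
by have [<-|//] := eqVneq x y; rewrite is_open_mem.
Qed.

Lemma max_open_closer_max p : max_open p -> max_open (rcons p (max_label p)) = false.
Proof.
move=> /is_open_mem mp.
by rewrite /max_open max_label_rcons_mem // is_open_rcons eqxx mp.
Qed.

Lemma open_below_max_closer_max p :
  max_open p -> open_below_max (rcons p (max_label p)) = open_below_max p.
Proof.
move=> om; rewrite open_below_max_closer //; apply/all_filterP/allP => y.
by rewrite mem_open_below_max => /andP [_ /ltn_eqF ->].
Qed.

Lemma max_open_closer_below p a s :
  open_below_max p = a :: s -> max_open (rcons p a) = max_open p.
Proof.
case/open_below_max_cons => oa am _.
by rewrite /max_open max_label_rcons_mem ?is_open_mem // is_open_rcons (ltn_eqF am).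
Qed.

Lemma open_below_max_closer_below p a s :
  open_below_max p = a :: s -> open_below_max (rcons p a) = s.
Proof.
move=> pE; have [oa _ s_lt] := open_below_max_cons pE.
rewrite open_below_max_closer // pE /= eqxx; apply/all_filterP/allP => y.
by move/s_lt/ltn_eqF ->.
Qed.

(** * Restricted growth words *)

Definition rg_word (w : seq nat) : Prop :=
  forall u x v, w = u ++ x :: v -> x \notin u -> x = (max_label u).+1.

Definition doubled (w : seq nat) : bool := all (fun y => count_mem y w == 2) w.

Lemma rg_word_prefix u v : rg_word (u ++ v) -> rg_word u.
Proof. by move=> rg u' x v' uE; apply: (rg _ _ (v' ++ v)); rewrite uE -catA. Qed.

Lemma rg_word_rcons u x :
  rg_word (rcons u x) -> rg_word u /\ (x \notin u -> x = (max_label u).+1).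
Proof.
rewrite -cats1 => rg; split; first exact: rg_word_prefix rg.
by apply: rg.
Qed.

Lemma rg_word_ind (P : seq nat -> Prop) :
  P [::] ->
  (forall u x, P u -> x \in u \/ x = (max_label u).+1 -> P (rcons u x)) ->
  forall w, rg_word w -> P w.
Proof.
move=> P0 PS; elim/last_ind => [|u x IH] // /rg_word_rcons [rgu xE].
by apply: PS; [exact: IH | have [xu|/xE] := boolP (x \in u); [left | right]].
Qed.

Lemma iota_subseq_rg_word w : rg_word w -> subseq (iota 1 (max_label w)) w.
Proof.
elim/rg_word_ind => [|{}w x IH [xw|->]]; first by rewrite /max_label big_nil.
  by rewrite max_label_rcons_mem // (subseq_trans IH) ?subseq_rcons.
rewrite max_label_opener iota_rcons add1n -!cats1.
exact: cat_subseq IH (subseq_refl _).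
Qed.

Lemma rg_word_gt0 w : rg_word w -> {in w, forall y, 0 < y}.
Proof.
elim/rg_word_ind => // u x IH ux y; rewrite mem_rcons inE => /predU1P [->|/IH //].
by case: ux => [/IH|->].
Qed.

Lemma subseq_rg_word s w : rg_word w -> sorted ltn s ->
  {in s, forall y, 0 < y <= max_label w} -> subseq s w.
Proof.
move=> rg s_sorted s_le; apply: subseq_trans (iota_subseq_rg_word rg).
apply/subseq_uniqP; first exact: iota_uniq.
apply: (irr_sorted_eq ltn_trans ltnn) => // [|y].
  by apply: sorted_filter (iota_ltn_sorted 1 _); apply: ltn_trans.
rewrite mem_filter mem_iota add1n ltnS andb_idr // => ys.
exact: s_le.
Qed.

Lemma rg_word_kernel_inj w w' :
  rg_word w -> rg_word w' -> size w = size w' ->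
  (forall i j, i < size w -> j < size w ->
     (nth 0 w i == nth 0 w j) = (nth 0 w' i == nth 0 w' j)) ->
  w = w'.
Proof.
elim/last_ind: w w' => [|u x IH] w'; first by move=> _ _ /esym/size0nil ->.
case/lastP: w' => [|u' x'] /rg_word_rcons [rgu xE] rg'; rewrite !size_rcons //.
case=> sz ker.
have [rgu' x'E] := rg_word_rcons rg'.
have uE : u = u'.
  apply: IH => // i j iu ju; have := ker i j (ltnW iu) (ltnW ju).
  by rewrite !nth_rcons -sz iu ju.
have same_old y : y \in u -> (y == x) = (y == x').
  case/(nthP 0) => i iu <-; have := ker i (size u) (ltnW iu) (ltnSn _).
  by rewrite !nth_rcons -uE iu ltnn eqxx.
rewrite -uE in x'E *; congr rcons.
have [xu|xu] := boolP (x \in u); first by apply/eqP; rewrite -same_old.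
rewrite xE // x'E //; apply: contra xu => xu'.
by have := same_old x' xu'; rewrite eqxx => /eqP <-.
Qed.

(** * Words avoiding 12312 *)

Lemma word_containsP w tau :
  reflect (exists2 s, subseq s w & order_iso s tau) (word_contains w tau).
Proof.
apply: (iffP existsP) => [[c sc]|[_ /subseqP [c sz ->] sc]].
  by exists (mask c w); first exact: mask_subseq.
have szc : size c == size w by rewrite sz.
by exists (Tuple szc).
Qed.

Lemma order_isoP s tau :
  reflect (size s = size tau /\
           forall i j, i < size s -> j < size s ->
             (nth 0 s i < nth 0 s j) = (nth 0 tau i < nth 0 tau j))
          (order_iso s tau).
Proof.
apply: (iffP andP) => -[/eqP sz iso]; split=> //.
  move=> i j si sj.
  by have /forallP /(_ (Ordinal sj)) /eqP := forallP iso (Ordinal si).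
by apply/forallP => i; apply/forallP => j; apply/eqP/iso.
Qed.

Lemma order_iso_12312 s :
  order_iso s [:: 1; 2; 3; 1; 2] <->
  exists a b c, [/\ a < b, b < c & s = [:: a; b; c; a; b]].
Proof.
split=> [/order_isoP [+ iso]|[a [b [c [ab bc ->]]]]]; last first.
  apply/order_isoP; split=> //.
  by case=> [|[|[|[|[|i]]]]] [|[|[|[|[|j]]]]] //= _ _; lia.
case: s iso => [|a [|b [|c [|d [|e [|]]]]]] // iso _.
have /= ab := iso 0 1 isT isT; have /= bc := iso 1 2 isT isT.
have /= ad := iso 0 3 isT isT; have /= da := iso 3 0 isT isT.
have /= be := iso 1 4 isT isT; have /= eb := iso 4 1 isT isT.
have dE : d = a by lia.
have eE : e = b by lia.
by exists a, b, c; rewrite dE eE ab bc.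
Qed.

Lemma word_contains_12312 w :
  reflect (exists a b c, [/\ a < b, b < c & subseq [:: a; b; c; a; b] w])
          (word_contains w [:: 1; 2; 3; 1; 2]).
Proof.
apply: (iffP (word_containsP _ _)) => [[s sw /order_iso_12312]|].
  by case=> [a [b [c [ab bc sE]]]]; exists a, b, c; rewrite -sE.
case=> [a [b [c [ab bc sw]]]]; exists [:: a; b; c; a; b] => //.
by apply/order_iso_12312; exists a, b, c.
Qed.

Definition legal (w : seq nat) : Prop :=
  forall u x v, w = u ++ x :: v -> x \in next_labels u.

Lemma accepts_legal w :
  accepts next_labels rcons all_closed [::] w <-> legal w /\ all_closed w.
Proof.
have foldlE u : foldl rcons [::] u = u.
  by elim/last_ind: u => // u x IH; rewrite foldl_rcons IH.
by rewrite acceptsP foldlE /legal; split=> -[lw cw]; split=> // u x v /lw;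
  rewrite foldlE.
Qed.

Lemma legal_rg_word w : legal w -> rg_word w.
Proof.
by move=> lw u x v /lw /next_labelsP [-> //|[/is_open_mem ->]].
Qed.

Lemma legal_count_le2 w y : legal w -> count_mem y w <= 2.
Proof.
elim/last_ind: w => // u x IH lw.
have /IH cu : legal u.
  by move=> u' z v uE; apply: (lw _ _ (rcons v x)); rewrite uE rcons_cat.
rewrite count_mem_rcons; have [<-|_] := eqVneq x y; last by rewrite addn0.
have /next_labelsP [xE|[/eqP -> //]] := lw u x [::] (esym (cats1 u x)).
by rewrite (count_memPn _) // xE max_label_notin.
Qed.

Lemma legal_doubled w : legal w -> doubled w = all_closed w.
Proof.
move=> lw; rewrite /doubled /all_closed -all_predC; apply: eq_in_all => y wy /=.
have := legal_count_le2 y lw; rewrite /is_open; move: wy.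
by rewrite -has_pred1 has_count; case: (count_mem y w) => [|[|[]]].
Qed.

Lemma legal_avoids_12312 w : legal w -> ~~ word_contains w [:: 1; 2; 3; 1; 2].
Proof.
move=> lw; apply/word_contains_12312 => -[a [b [c [ab bc]]]].
case/(@subseq_cat_cons _ [:: a; b; c] [:: b]) => u [v [wE su]].
rewrite sub1seq => bv; have inu := mem_subseq su.
have /next_labelsP [aE|[_ a_top]] := lw u a v wE.
  by have := inu a; rewrite !inE eqxx aE (negPf (max_label_notin u)) => /(_ isT).
have bu : b \in u by rewrite inu // !inE eqxx orbT.
have cu : c <= max_label u by rewrite leq_max_label // inu // !inE eqxx !orbT.
have := a_top b; rewrite ab (leq_trans bc cu) => /(_ isT) /eqP; apply.
have := legal_count_le2 b lw; rewrite wE count_cat /= (ltn_eqF ab).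
move: bu bv; rewrite -!has_pred1 !has_count.
by move: (count_mem b u) (count_mem b v) => k l; lia.
Qed.

(* If [x] is closed after [u] while some [y > x] below the largest label [z] of
   [u] is open, then [x], [y], [z] are opened in this order within [u], and [y]
   is closed after [x]: this is a pattern 12312. *)
Lemma avoids_12312_legal w :
  rg_word w -> doubled w -> ~~ word_contains w [:: 1; 2; 3; 1; 2] -> legal w.
Proof.
move=> rg /allP dw avoid u x v wE; apply/next_labelsP.
have [xu|xu] := boolP (x \in u); [right | left; exact: rg wE xu].
have rgu : rg_word u by apply: (@rg_word_prefix _ (x :: v)); rewrite -wE.
have count_u y : y \in u -> count_mem y u + (x == y) + count_mem y v = 2.
  move=> yu; have /eqP <- : count_mem y w == 2 by apply: dw; rewrite wE mem_cat yu.
  by rewrite wE count_cat /= addnA.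
split=> [|y /andP [xy ym]].
  by have := count_u x xu; move: xu; rewrite /is_open eqxx -has_pred1 has_count; lia.
apply: contraNN avoid => oy; apply/word_contains_12312.
exists x, y, (max_label u); split=> //; rewrite wE.
apply: (@cat_subseq _ [:: x; y; max_label u] [:: x; y]).
  apply: subseq_rg_word => //; first by rewrite /= xy ym.
  by move=> z; have := rg_word_gt0 rgu xu; rewrite !inE => x0 /or3P [] /eqP ->; lia.
rewrite /= eqxx sub1seq -has_pred1 has_count.
by have := count_u y (is_open_mem oy); rewrite (eqP oy) (ltn_eqF xy); lia.
Qed.

Lemma accepts_12312_avoiding w :
  accepts next_labels rcons all_closed [::] w <->
  [/\ rg_word w, doubled w & ~~ word_contains w [:: 1; 2; 3; 1; 2]].
Proof.
rewrite accepts_legal; split=> [[lw cw]|[rg dw avoid]].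
  by split; [exact: legal_rg_word | rewrite legal_doubled | exact: legal_avoids_12312].
have lw := avoids_12312_legal rg dw avoid.
by rewrite -legal_doubled.
Qed.

(** * Canonical sequential forms *)

Lemma edge_min_le m (B : {set 'I_m}) (i : 'I_m) : i \in B -> edge_min B <= i.
Proof.
move=> iB; rewrite /edge_min; have := mem_index_enum i.
elim: (index_enum _) => //= j s IH; rewrite inE big_cons => /predU1P [<-|/IH].
  by rewrite iB geq_minl.
by case: ifP => // _; exact: leq_trans (geq_minr _ _).
Qed.

Lemma edge_min_mem m (B : {set 'I_m}) : B != set0 ->
  exists2 j : 'I_m, j \in B & edge_min B = j.
Proof.
case/set0Pn=> i iB; case: (arg_minnP (fun j : 'I_m => j : nat) iB) => j jB jmin.
exists j => //; apply/eqP; rewrite eqn_leq edge_min_le //= /edge_min.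
apply: (big_ind (leq j)) => // [|x y jx jy]; first exact/ltnW/ltn_ord.
by rewrite leq_min jx.
Qed.

Lemma ltn_edge_label m (M : {set {set 'I_m}}) B C : B \in M -> C \in M ->
  (edge_label M B < edge_label M C) = (edge_min B < edge_min C).
Proof.
move=> MB MC; have [BC|CB] := ltnP (edge_min B) (edge_min C).
  apply/proper_card/properP; split.
    by apply/subsetP => D; rewrite !inE => /andP [-> /leq_trans ->] //; apply: ltnW.
  by exists C; rewrite !inE MC ?leqnn // -ltnNge.
apply/negbTE; rewrite -leqNgt; apply/subset_leq_card/subsetP => D.
by rewrite !inE => /andP [-> /leq_trans ->].
Qed.

Lemma edge_label_bounds m (M : {set {set 'I_m}}) B :
  B \in M -> 0 < edge_label M B <= #|M|.
Proof.
move=> MB; apply/andP; split; first by apply/card_gt0P; exists B; rewrite !inE MB /=.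
by apply/subset_leq_card/subsetP => C; rewrite inE => /andP [].
Qed.

Lemma size_canonical_form m (M : {set {set 'I_m}}) : size (canonical_form M) = m.
Proof. by rewrite size_map size_enum_ord. Qed.

Lemma nth_canonical_form m (M : {set {set 'I_m}}) (i : 'I_m) :
  nth 0 (canonical_form M) i = edge_label M (pblock M i).
Proof. by rewrite (nth_map i) ?size_enum_ord // nth_ord_enum. Qed.

Section CanonicalForm.

Variables (m : nat) (M : {set {set 'I_m}}).
Hypothesis partM : partition M [set: 'I_m].

Let coverM i : i \in cover M.
Proof. by rewrite (cover_partition partM) inE. Qed.

Let trivM : trivIset M.
Proof. by case/and3P: partM. Qed.

Let pblockM i : pblock M i \in M.
Proof. by rewrite pblock_mem. Qed.

Lemma edge_min_pblock_le i : edge_min (pblock M i) <= i.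
Proof. by rewrite edge_min_le // mem_pblock. Qed.

Lemma edge_min_pblock B : B \in M ->
  exists2 i : 'I_m, pblock M i = B & edge_min B = i.
Proof.
move=> MB; have [|i iB iE] := @edge_min_mem _ B.
  by apply: contraTneq MB => ->; case/and3P: partM.
by exists i; first exact: def_pblock.
Qed.

Lemma edge_label_inj : {in M &, injective (edge_label M)}.
Proof.
move=> B C MB MC BC.
have minE : edge_min B = edge_min C.
  by have [] := ltngtP (edge_min B) (edge_min C);
    rewrite // -(@ltn_edge_label _ M) // BC ltnn.
have [i iB Bi] := edge_min_pblock MB; have [j jC Cj] := edge_min_pblock MC.
suff ij : i = j by rewrite -iB -jC ij.
by apply: val_inj; rewrite /= -Bi -Cj.
Qed.

Lemma edge_label_surj y : 0 < y <= #|M| -> exists2 B, B \in M & edge_label M B = y.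
Proof.
move=> yM.
have labels_uniq : uniq [seq edge_label M B | B <- enum M].
  rewrite map_inj_in_uniq ?enum_uniq // => B C; rewrite !mem_enum.
  exact: edge_label_inj.
have labels_le : {subset [seq edge_label M B | B <- enum M] <= iota 1 #|M|}.
  by move=> _ /mapP [B + ->]; rewrite mem_enum mem_iota add1n; apply: edge_label_bounds.
have [|_ labelsE] := uniq_min_size labels_uniq labels_le.
  by rewrite size_iota size_map -cardE.
have : y \in iota 1 #|M| by rewrite mem_iota add1n ltnS.
by rewrite -labelsE => /mapP [B + ->]; rewrite mem_enum; exists B.
Qed.

Lemma edge_label_before (j : 'I_m) y : edge_min (pblock M j) = j ->
  (exists2 i : 'I_m, i < j & edge_label M (pblock M i) = y) <->
  0 < y < edge_label M (pblock M j).
Proof.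
move=> minj; split=> [[i ij <-]|/andP [y0 yj]].
  have /andP [-> _] := edge_label_bounds (pblockM i).
  by rewrite ltn_edge_label ?pblockM // minj (leq_ltn_trans (edge_min_pblock_le i)).
have [|B MB yE] := @edge_label_surj y.
  have /andP [_ jM] := edge_label_bounds (pblockM j).
  by rewrite y0 (leq_trans (ltnW yj)).
have [i iB iE] := edge_min_pblock MB.
exists i; last by rewrite iB.
by rewrite -minj -iE -(ltn_edge_label MB) ?pblockM // yE.
Qed.

Lemma canonical_form_kernel (i j : 'I_m) :
  (nth 0 (canonical_form M) i == nth 0 (canonical_form M) j) =
  (pblock M i == pblock M j).
Proof. by rewrite !nth_canonical_form (inj_in_eq edge_label_inj). Qed.

Lemma canonical_formK :
  preim_partition (fun i : 'I_m => nth 0 (canonical_form M) i) [set: 'I_m] = M.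
Proof.
rewrite -[RHS](preim_partition_pblock partM).
by apply: eq_imset => i; apply/setP => j; rewrite !inE canonical_form_kernel.
Qed.

Lemma canonical_form_rg_word : rg_word (canonical_form M).
Proof.
move=> u x v wE xu.
have um : size u < m.
  by rewrite -(size_canonical_form M) wE size_cat /= -addSnnS leq_addr.
pose j := Ordinal um.
have xE : x = edge_label M (pblock M j).
  by rewrite -nth_canonical_form wE nth_cat ltnn subnn.
have mem_u y : y \in u <-> exists2 i : 'I_m, i < j & edge_label M (pblock M i) = y.
  have nth_u (i : 'I_m) : i < j -> nth 0 u i = edge_label M (pblock M i).
    by move=> ij; rewrite -nth_canonical_form wE nth_cat ij.
  split=> [/(nthP 0) [i iu <-]|[i ij <-]]; last by rewrite -nth_u ?mem_nth.
  by exists (Ordinal (ltn_trans iu um)); rewrite -?nth_u.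
have minj : edge_min (pblock M j) = j.
  have [i iB iE] := edge_min_pblock (pblockM j).
  rewrite iE; apply/eqP; rewrite eqn_leq -{1}iE edge_min_pblock_le leqNgt.
  by apply: contra xu => ij; apply/mem_u; exists i; rewrite // iB.
apply: max_label_initial => [|y]; rewrite xE.
  by case/andP: (edge_label_bounds (pblockM j)).
by apply/idP/idP => [/mem_u|] /(edge_label_before y minj) // /mem_u.
Qed.

Lemma count_canonical_form (i : 'I_m) :
  count_mem (nth 0 (canonical_form M) i) (canonical_form M) = #|pblock M i|.
Proof.
rewrite count_map enumT -size_filter cardE; congr size; apply: eq_filter => j /=.
by rewrite -nth_canonical_form canonical_form_kernel eq_sym eq_pblock.
Qed.

Lemma doubled_canonical_form :
  doubled (canonical_form M) = [forall B in M, #|B| == 2].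
Proof.
apply/allP/forall_inP => [dw B MB|M2 _ /(nthP 0) [i + <-]].
  have [i <- _] := edge_min_pblock MB.
  by rewrite -count_canonical_form dw // mem_nth // size_canonical_form.
rewrite size_canonical_form => im.
by rewrite (count_canonical_form (Ordinal im)) M2.
Qed.

End CanonicalForm.

Lemma canonical_form_inj m :
  {in [pred M | partition M [set: 'I_m]] &, injective (@canonical_form m)}.
Proof.
move=> M M'; rewrite !inE => pM pM' E.
by rewrite -(canonical_formK pM) E canonical_formK.
Qed.

Lemma rg_word_canonical_form m w : rg_word w -> size w = m ->
  exists2 M : {set {set 'I_m}}, partition M [set: 'I_m] & canonical_form M = w.
Proof.
move=> rg sz; pose letter (i : 'I_m) := nth 0 w i.
pose M := preim_partition letter [set: 'I_m].
have pM : partition M [set: 'I_m] := preim_partitionP letter _.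
exists M => //; apply: rg_word_kernel_inj => //; first exact: canonical_form_rg_word.
  by rewrite size_canonical_form sz.
move=> i j; rewrite size_canonical_form => im jm.
rewrite (canonical_form_kernel pM (Ordinal im) (Ordinal jm)).
have [/eqP coverM trivM _] := and3P pM.
rewrite eq_pblock ?coverM ?inE // pblock_equivalence_partition ?inE //.
by split=> // /eqP ->.
Qed.

Lemma is_matchingE n (M : {set {set 'I_(2 * n)}}) :
  is_matching M = partition M [set: 'I_(2 * n)] && [forall B in M, #|B| == 2].
Proof.
rewrite /is_matching; have [pM|] //= := boolP (partition M _).
rewrite andb_idl // => /forall_inP M2.
have /(card_uniform_partition)/(_ pM) : {in M, forall B : {set _}, #|B| = 2}.
  by move=> B /M2 /eqP.
by rewrite cardsT card_ord => /eqP; rewrite [_ * 2]mulnC eqn_pmul2l // eq_sym.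
Qed.

Definition matching_word n tau
    (M : {M : {set {set 'I_(2 * n)}} | is_matching M && avoids M tau}) : seq nat :=
  canonical_form (val M).

Lemma matching_word_inj n tau : injective (@matching_word n tau).
Proof.
move=> [M MP] [M' MP'] E; apply: val_inj.
have /andP [/and3P [pM _ _] _] := MP; have /andP [/and3P [pM' _ _] _] := MP'.
by apply: canonical_form_inj.
Qed.

Lemma matching_wordP n tau w :
  (exists M, @matching_word n tau M = w) <->
  [/\ size w = 2 * n, rg_word w, doubled w & ~~ word_contains w tau].
Proof.
rewrite /matching_word; split=> [[[M MP] /= <-]|[sz rg dw avoid]].
  have /andP [+ avoid] := MP; rewrite is_matchingE => /andP [pM M2].
  split; rewrite ?size_canonical_form ?doubled_canonical_form //.
  exact: canonical_form_rg_word.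
have [M pM wE] := rg_word_canonical_form rg sz.
have MP : is_matching M && avoids M tau.
  by rewrite is_matchingE pM -doubled_canonical_form // /avoids wE dw.
by exists (exist _ M MP).
Qed.

(** * Shapes with at most one square outside the first row *)

Definition near_row (la : seq nat) : bool := is_partn la && row_or_near_row la.

Definition row (k : nat) : seq nat := if k is 0 then [::] else [:: k].

Definition shape_next (la : seq nat) : seq (seq nat) :=
  match la with
  | [::] => [:: row 1]
  | [:: k.+1] => [:: row k.+2; row k; [:: k.+1; 1]]
  | [:: k.+1; 1] => row k.+1 :: (if k is 0 then [::] else [:: [:: k; 1]])
  | _ => [::]
  end.

Variant near_row_spec : seq nat -> Prop :=
  | NearRowEmpty : near_row_spec [::]
  | NearRowRow k : near_row_spec [:: k.+1]
  | NearRowHook k : near_row_spec [:: k.+1; 1].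

Lemma near_rowP la : near_row la -> near_row_spec la.
Proof.
rewrite /near_row /is_partn.
case: la => [|[|k] [|[|[|c]] [|d la]]] //=; rewrite ?inE ?andbF //= => _.
- exact: NearRowEmpty.
- exact: NearRowRow.
- exact: NearRowHook.
Qed.

Lemma shape_next_near_row la : near_row la -> all near_row (shape_next la).
Proof. by case/near_rowP=> // [[|k]|[|k]]. Qed.

Lemma shape_next_uniq la : uniq (shape_next la).
Proof.
by case: la => [|[|k] [|[|[|c]] [|d la]]] //; case: k => [|k] //=;
  rewrite !inE !eqseq_cons; lia.
Qed.

Lemma add_squareE la mu :
  add_square la mu = has (fun i => mu == incr_nth la i) (iota 0 (size la).+1).
Proof.
apply/existsP/hasP => [[i /eqP ->]|[i]].
  by exists (nat_of_ord i); rewrite // mem_iota ltn_ord.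
by rewrite mem_iota => /= li /eqP ->; exists (Ordinal li).
Qed.

Lemma mem_shape_next_near_row la mu : near_row la -> near_row mu ->
  (mu \in shape_next la) = osc_step la mu && ~~ forbidden_step la mu.
Proof.
rewrite /osc_step !add_squareE.
case/near_rowP => [|[|k]|[|k]]; case/near_rowP => [|l|l] //=;
  rewrite ?inE ?eqseq_cons ?andbT ?andbF ?orbF /=; lia.
Qed.

Lemma mem_shape_next la mu : near_row la ->
  (mu \in shape_next la) =
  [&& near_row mu, osc_step la mu & ~~ forbidden_step la mu].
Proof.
move=> la_near; have [mu_near|mu_far] := boolP (near_row mu).
  exact: mem_shape_next_near_row.
by apply: contraNF mu_far; apply: (allP (shape_next_near_row la_near)).
Qed.

Local Notation word_runs := (runs next_labels rcons all_closed).
Local Notation shape_runs := (runs shape_next (fun _ mu => mu) (pred1 [::])).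
Local Notation shape_accepts := (accepts shape_next (fun _ mu => mu) (pred1 [::])).

Lemma accepts_shape la s : near_row la ->
  shape_accepts la s =
  [&& all near_row s, path osc_step la s,
      path [rel x y | ~~ forbidden_step x y] la s & last la s == [::]].
Proof.
elim: s la => [|mu s IH] la la_near //=.
rewrite mem_shape_next //; have [mu_near|] //= := boolP (near_row mu).
by rewrite IH //; case: (osc_step la mu); case: (forbidden_step la mu); rewrite ?andbF.
Qed.

Lemma restricted_osc_tableauE l (t : l.+1.-tuple (seq nat)) :
  restricted_osc_tableau t =
  (thead t == [::]) && shape_accepts [::] (behead t).
Proof.
rewrite /restricted_osc_tableau /is_osc_tableau.
case/tupleP: t => la s; rewrite theadE /=.
rewrite !(tnth_nth [::]) /=.
have -> : nth [::] (la :: s) l = last la s.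
  by rewrite -[RHS]/(last [::] (la :: s)) -nth_last /= size_tuple.
have [->|] := eqVneq la [::]; rewrite ?andbF //=.
rewrite accepts_shape // (all_predI is_partn row_or_near_row).
case: (all is_partn s) => //=; case: (last _ _ == _); rewrite ?andbF ?andbT //.
by case: (path osc_step _ _); rewrite ?andbF.
Qed.

Definition later_shapes l
    (t : {t : l.+1.-tuple (seq nat) | restricted_osc_tableau t}) : seq (seq nat) :=
  behead (val t).

Lemma later_shapes_inj l : injective (@later_shapes l).
Proof.
move=> [t tP] [t' tP']; rewrite /later_shapes /= => E; apply/val_inj/val_inj => /=.
move: tP tP' E; rewrite !restricted_osc_tableauE.
case/tupleP: t => x t; case/tupleP: t' => x' t'; rewrite !theadE /=.
by move=> /andP [/eqP -> _] /andP [/eqP -> _] ->.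
Qed.

Lemma mem_shape_runs_tableau l s :
  s \in shape_runs l [::] <-> exists t, @later_shapes l t = s.
Proof.
rewrite mem_runs /later_shapes; split=> [/andP [sz acc]|[[t tP] /= <-]]; last first.
  by move: tP; rewrite restricted_osc_tableauE size_behead size_tuple eqxx => /andP [].
have szs : size ([::] :: s) == l.+1 by [].
have tP : restricted_osc_tableau (Tuple szs).
  by rewrite restricted_osc_tableauE /thead (tnth_nth [::]) /= acc.
by exists (exist (fun t => is_true (restricted_osc_tableau t)) _ tP).
Qed.

(** * Equal numbers of runs *)

Lemma size_shape_runs_row N k :
  size (shape_runs N.+1 (row k)) =
  size (shape_runs N (row k.+1)) +
  (if k is k'.+1 then
     size (shape_runs N (row k')) + size (shape_runs N [:: k; 1])
   else 0).
Proof. by rewrite size_runsS; case: k => [|k]; rewrite !big_cons big_nil ?addn0. Qed.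

(* The junk shape [:: 0; 1] has no run: it is not final and has no successor. *)
Lemma size_shape_runs_hook0 N : size (shape_runs N [:: 0; 1]) = 0.
Proof. by case: N. Qed.

Lemma size_shape_runs_hook N k :
  size (shape_runs N.+1 [:: k; 1]) =
  if k is k'.+1 then
    size (shape_runs N (row k)) + size (shape_runs N [:: k'; 1])
  else 0.
Proof.
case: k => [|[|k]]; rewrite size_runsS ?big_cons ?big_nil ?addn0 //.
by rewrite size_shape_runs_hook0 addn0.
Qed.

Lemma size_word_runsS N p :
  size (word_runs N.+1 p) =
  size (word_runs N (rcons p (max_label p).+1)) +
  (if max_open p then size (word_runs N (rcons p (max_label p))) else 0) +
  (if open_below_max p is a :: _ then size (word_runs N (rcons p a)) else 0).
Proof.
rewrite size_runsS big_cons big_cat -addnA; congr (_ + (_ + _)).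
  by case: ifP; rewrite ?big_seq1 ?big_nil.
by case: (open_below_max p) => [|a s]; rewrite ?big_nil //= take0 big_seq1.
Qed.

(* While the largest label is open, its opener stands both for a square added to
   the first row and for a square added to the second row, whence the sum. *)
Lemma size_word_runs N p :
  size (word_runs N p) =
  if max_open p then
    size (shape_runs N (row (size (open_below_max p)).+1)) +
    size (shape_runs N [:: size (open_below_max p); 1])
  else size (shape_runs N (row (size (open_below_max p)))).
Proof.
elim: N p => [|N IH] p.
  by rewrite !size_runs0 all_closedE; case: max_open; case: (open_below_max p).
rewrite size_word_runsS !size_shape_runs_row size_shape_runs_hook !IH.
rewrite max_open_opener open_below_max_opener.
case om : (max_open p);
  rewrite ?(max_open_closer_max om) ?(open_below_max_closer_max om);
  case oE : (open_below_max p) => [|a s] /=.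
- lia.
- rewrite IH (max_open_closer_below oE) (open_below_max_closer_below oE) om /=; lia.
- by rewrite size_shape_runs_hook0 !addn0.
- rewrite IH (max_open_closer_below oE) (open_below_max_closer_below oE) om /=; lia.
Qed.

Lemma mem_word_runs_matching n w :
  w \in word_runs (2 * n) [::] <->
  exists M, @matching_word n [:: 1; 2; 3; 1; 2] M = w.
Proof.
rewrite matching_wordP mem_runs.
split=> [/andP [/eqP -> /accepts_12312_avoiding [rg dw aw]]|[-> rg dw aw]] //.
by rewrite eqxx; apply/accepts_12312_avoiding.
Qed.

Theorem theorem4 (n : nat) (hn : 1 <= n) :
  exists f : {M : {set {set 'I_(2 * n)}} |
                is_matching M && avoids M [:: 1; 2; 3; 1; 2]} ->
             {t : (2 * n).+1.-tuple (seq nat) | restricted_osc_tableau t},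
    bijective f.
Proof.
have size_runs_eq : size (word_runs (2 * n) [::]) = size (shape_runs (2 * n) [::]).
  by rewrite size_word_runs /open_below_max /max_label big_nil.
apply: (bijective_of_enumerations
  (@matching_word_inj n _) _ (@mem_word_runs_matching n)
  (@later_shapes_inj _) _ (@mem_shape_runs_tableau _) size_runs_eq).
- exact: runs_uniq next_labels_uniq _ _.
- exact: runs_uniq shape_next_uniq _ _.
Qed.
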